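(* Let $\mu$ be a locally-valid MV assignment of the Huffman grid tessellation and let $F$ be any face of it. Then the MV assignment $\mu_F$ obtained from $\mu$ by flipping $F$ is not locally valid.
   Context: Huffman grid: fix an angle $0<\alpha<\pi/2$ and a convex quadrilateral tile (a kite) in which two opposite corners have right angles and the other two opposite corners have angles $\alpha$ and $\pi-\alpha$. The Huffman grid is the edge-to-edge monohedral tiling of the whole plane by copies of this tile in which neighbouring tiles are related by the $180^\circ$ rotation about the midpoint of their common edge. Every vertex then has degree 4, with sector angles, in cyclic order, $\alpha,\ \pi/2,\ \pi-\alpha,\ \pi/2$, one sector coming from each of the four types of corner of the tile. The faces are the tiles, and the creases are the edges of the tiling. A mountain-valley (MV) assignment is a function $\mu$ from the set of creases to $\{-1,1\}$ ($1$ = mountain, $-1$ = valley). It is locally valid if each vertex, taken by itself, can be folded flat according to $\mu$ without self-intersection; for the vertices of a Huffman grid (degree 4 with a unique smallest sector angle $\alpha$) this means that at each vertex (i) the sum of $\mu$ over the four incident creases is $2$ or $-2$, and (ii) the two creases bordering the sector of angle $\alpha$ have opposite values of $\mu$. Flipping a face $F$ under $\mu$ produces the MV assignment $\mu_F$ with $\mu_F(e)=-\mu(e)$ for every crease $e$ bordering $F$ and $\mu_F(e)=\mu(e)$ for all other creases. *)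

(* Defs.v *)
From HB Require Import structures.
From mathcomp Require Import all_boot all_order all_algebra.
From mathcomp Require Import all_classical all_reals all_analysis.

Set Implicit Arguments.
Unset Strict Implicit.
Unset Printing Implicit Defensive.

Import Order.TTheory GRing.Theory Num.Theory.

Local Open Scope classical_set_scope.
Local Open Scope ring_scope.

Section HuffmanGrid.
Variable R : realType.

Notation point := 'rV[R]_2.

Definition dot (u v : point) : R := \sum_j u 0 j * v 0 j.

(* The library norm on row vectors is the sup norm. *)
Definition enorm (u : point) : R := Num.sqrt (dot u u).

Definition cross (u v : point) : R := u 0 0 * v 0 1 - u 0 1 * v 0 0.

Definition segment (p q : point) : set point :=
  [set x | exists2 s : R, 0 <= s <= 1 & x = (1 - s) *: p + s *: q].

Definition midpoint (p q : point) : point := 2^-1 *: (p + q).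

Definition half_turn (c x : point) : point := c *+ 2 - x.

(* A quadrilateral is given by its corners in cyclic order; corner indices
   are added modulo 4, and side i joins corner i to corner i + 1. *)
Definition tile := {ffun 'I_4 -> point}.

Definition side (t : tile) (i : 'I_4) : set point := segment (t i) (t (i + 1)).

Definition corner_angle (t : tile) (i : 'I_4) : R :=
  let u := t (i + 1) - t i in
  let v := t (i - 1) - t i in
  acos (dot u v / (enorm u * enorm v)).

(* Four strict left turns: a non-degenerate convex quadrilateral listed
   counterclockwise. *)
Definition convex_tile (t : tile) : Prop :=
  forall i : 'I_4, 0 < cross (t (i + 1) - t i) (t (i + 1 + 1) - t (i + 1)).

(* Corner 0 carries the angle alpha; as a kite is symmetric about the diagonal
   through corners 0 and 2, listing it counterclockwise loses no generality. *)
Definition huffman_tile (alpha : R) (t : tile) : Prop :=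
  [/\ convex_tile t,
      enorm (t 1 - t 0) = enorm (t 3 - t 0) /\
      enorm (t 1 - t 2) = enorm (t 3 - t 2),
      corner_angle t 0 = alpha /\ corner_angle t 2 = pi - alpha &
      corner_angle t 1 = pi / 2 /\ corner_angle t 3 = pi / 2].

Definition neighbour (t : tile) (i : 'I_4) : tile :=
  [ffun j => half_turn (midpoint (t i) (t (i + 1))) (t j)].

(* The faces of the grid containing the tile K. In the tiling, the tile on the
   other side of each side of a tile is its half-turn about the midpoint of
   that side, and any two tiles are linked by a chain of neighbours, so the
   faces are exactly the tiles reached from K in this way. *)
Inductive face (K : tile) : set tile :=
| face_base : face K K
| face_neighbour t i : face K t -> face K (neighbour t i).

Definition crease (K : tile) : set (set point) :=
  [set e | exists t i, face K t /\ e = side t i].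

Definition vertex (K : tile) : set point :=
  [set v | exists t i, face K t /\ v = t i].

Definition incident (K : tile) (v : point) : set (set point) :=
  [set e | exists t i,
     [/\ face K t, e = side t i & v = t i \/ v = t (i + 1)]].

(* Only the values of mu on creases matter. *)
Definition MV_assignment (K : tile) (mu : set point -> int) : Prop :=
  forall e, crease K e -> mu e = 1 \/ mu e = -1.

(* The sector of a face t at its corner i is bordered by sides i - 1 and i.
   The sum is the finitely supported one of fsbigop. *)
Definition locally_valid_at (alpha : R) (K : tile) (mu : set point -> int)
    (v : point) : Prop :=
  (\sum_(e \in incident K v) mu e = 2 \/
   \sum_(e \in incident K v) mu e = -2) /\
  (forall t i, face K t -> t i = v -> corner_angle t i = alpha ->
     mu (side t (i - 1)) = - mu (side t i)).

Definition locally_valid (alpha : R) (K : tile) (mu : set point -> int) :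
    Prop :=
  forall v, vertex K v -> locally_valid_at alpha K mu v.

Definition borders (F : tile) : set (set point) := range (side F).

Definition flip (mu : set point -> int) (F : tile) : set point -> int :=
  fun e => if e \in borders F then - mu e else mu e.

End HuffmanGrid.

(* Main.v *)
(** At corner 1 of [F] the sector of angle [alpha] belongs to the neighbour [t]
    of [F] across side 0. It is bordered by side 0 of [F] and by a side of [t]
    lying strictly beyond the line through side 0, which is therefore not a
    side of [F]. So flipping [F] changes exactly one of two opposite values,
    making them equal. *)
Require Import Defs.
From HB Require Import structures.
From mathcomp Require Import all_boot all_order all_algebra.
From mathcomp Require Import all_classical all_reals all_analysis.
From mathcomp Require Import ring lra zify.

Set Implicit Arguments.
Unset Strict Implicit.
Unset Printing Implicit Defensive.

Import Order.TTheory GRing.Theory Num.Theory.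

Local Open Scope classical_set_scope.
Local Open Scope ring_scope.

Lemma neighbourE (R : realType) (t : tile R) (i j : 'I_4) :
  neighbour t i j = t i + t (i + 1) - t j.
Proof.
rewrite ffunE /half_turn /midpoint -scaler_nat scalerA divff ?pnatr_eq0 //.
by rewrite scale1r.
Qed.

Lemma neighbourB (R : realType) (t : tile R) (i j k : 'I_4) :
  neighbour t i j - neighbour t i k = - (t j - t k).
Proof. by rewrite !neighbourE !opprB addrC addrA subrK. Qed.

Lemma dotNN (R : realType) (u v : 'rV[R]_2) : dot (- u) (- v) = dot u v.
Proof. by apply: eq_bigr => j _; rewrite !mxE mulrNN. Qed.

Lemma crossNN (R : realType) (u v : 'rV[R]_2) : cross (- u) (- v) = cross u v.
Proof. by rewrite /cross !mxE !mulrNN. Qed.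

Lemma corner_angle_neighbour (R : realType) (t : tile R) (i j : 'I_4) :
  corner_angle (neighbour t i) j = corner_angle t j.
Proof. by rewrite /corner_angle /enorm !neighbourB !dotNN. Qed.

(** A half-turn negates the two vectors spanning a corner, which preserves their angle, and it keeps
    corner indices. Hence corner 0 carries [alpha] in every face. *)
Lemma corner_angle_face (R : realType) (K t : tile R) (j : 'I_4) :
  face K t -> corner_angle t j = corner_angle K j.
Proof. by elim=> // {}t i _ IH; rewrite corner_angle_neighbour. Qed.

Lemma convex_face (R : realType) (K t : tile R) :
  convex_tile K -> face K t -> convex_tile t.
Proof.
by move=> cK; elim=> // {}t i _ IH j; rewrite !neighbourB crossNN.
Qed.

Lemma segmentC (R : realType) (p q : 'rV[R]_2) : segment p q = segment q p.
Proof.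
suff sub (a b : 'rV[R]_2) : segment a b `<=` segment b a.
  by apply/seteqP; split; exact: sub.
move=> x [s /andP[s0 s1] ->]; exists (1 - s); first by apply/andP; split; lra.
by rewrite subKr addrC.
Qed.

Lemma segment_left (R : realType) (p q : 'rV[R]_2) : segment p q p.
Proof. by exists 0; rewrite ?lexx ?ler01 // subr0 scale1r scale0r addr0. Qed.

Lemma side_neighbour (R : realType) (t : tile R) (i : 'I_4) :
  side (neighbour t i) i = side t i.
Proof. by rewrite /side !neighbourE addrK addrAC subrr add0r segmentC. Qed.

(** The closed half-plane to the left of a directed line is convex, as [cross u (x - a)] is affine
    in [x]. *)
Lemma cross_segment_ge0 (R : realType) (u a p q x : 'rV[R]_2) :
  0 <= cross u (p - a) -> 0 <= cross u (q - a) ->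
  segment p q x -> 0 <= cross u (x - a).
Proof.
move=> hp hq [s /andP[s0 s1] ->].
have -> : cross u ((1 - s) *: p + s *: q - a) =
    (1 - s) * cross u (p - a) + s * cross u (q - a).
  by rewrite /cross !mxE; ring.
by rewrite addr_ge0 // mulr_ge0 // subr_ge0.
Qed.

Lemma cross_corner3_gt0 (R : realType) (t : tile R) :
  convex_tile t -> 0 < cross (t 1 - t 0) (t 3 - t 0).
Proof.
(* Index 3 of [convex_tile] is the left turn made at corner 0. *)
move=> /(_ 3); have -> : (3 + 1 : 'I_4) = 0 by exact/val_inj.
by rewrite add0r /cross !mxE; lra.
Qed.

Lemma convex_corner_left (R : realType) (t : tile R) (j : 'I_4) :
  convex_tile t -> 0 <= cross (t 1 - t 0) (t j - t 0).
Proof.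
(* Corners 0 and 1 lie on the line itself; the left turn at corner 1 (index 0) settles corner 2. *)
move=> ct; have := ct 0; have /ltW := cross_corner3_gt0 ct.
rewrite add0r; have -> : (1 + 1 : 'I_4) = 2 by exact/val_inj.
have : j \in [:: 0; 1; 2; 3] by case: j => -[|[|[|[]]]].
rewrite !inE => /or4P[] /eqP -> //; rewrite /cross !mxE; lra.
Qed.

Lemma side_neighbour_notin_borders (R : realType) (t : tile R) :
  convex_tile t -> ~ borders t (side (neighbour t 0) 3).
Proof.
move=> ct [i _ Ei].
(* The witness is the end [t 0 + t 1 - t 3] of the neighbour's side: its cross product with
   [t 1 - t 0] is the opposite of that of corner 3 of [t], hence negative. *)
have : side t i (neighbour t 0 3) by rewrite Ei; exact: segment_left.
move=> /(cross_segment_ge0 (convex_corner_left i ct)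
           (convex_corner_left (i + 1) ct)).
have := cross_corner3_gt0 ct.
by rewrite neighbourE add0r /cross !mxE; lra.
Qed.

Theorem theorem3p5 (R : realType) (alpha : R) (halpha : 0 < alpha < pi / 2)
    (K : tile R) (hK : huffman_tile alpha K)
    (mu : set 'rV[R]_2 -> int) (hmu : MV_assignment K mu)
    (hvalid : locally_valid alpha K mu)
    (F : tile R) (hF : face K F) :
  ~ locally_valid alpha K (flip mu F).
Proof.
move=> hflip; have [cK _ [aK _] _] := hK.
have cF := convex_face cK hF.
have ht : face K (neighbour F 0) by exact: face_neighbour.
have at0 : corner_angle (neighbour F 0) 0 = alpha.
  by rewrite (corner_angle_face _ ht).
(* This is corner 1 of [F], since the half-turn exchanges the ends of side 0. *)
have hv : vertex K (neighbour F 0 0) by exists (neighbour F 0), 0.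
have [_ /(_ _ _ ht erefl at0)] := hvalid _ hv.
have [_ /(_ _ _ ht erefl at0)] := hflip _ hv.
have -> : (0 - 1 : 'I_4) = 3 by exact/val_inj.
(* Side 3 of the neighbour keeps its value while the shared side 0 is negated, so the two conditions
   together force [mu (side F 0)] to be 0. *)
rewrite side_neighbour /flip memNset; last exact: side_neighbour_notin_borders.
rewrite mem_set; last by exists 0.
have hc : crease K (side F 0) by exists F, 0.
by case: (hmu _ hc) => ->; lia.
Qed.
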